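(* Let $C=\{c_1,c_2,c_3\}$ be a set of three candidates. For all sufficiently large integers $n$ (i.e. there is $N$ such that for every $n\ge N$), for a set of voters $V$ with $|V|=n$, there exists a strongly non-Borda social welfare function on $V$ and $C$ which satisfies all of U (unrestricted domain), MIIA, A (anonymity), N (neutrality), P (Pareto) and PR (positive responsiveness).
   Context: Setting. $V$ is a finite set of voters and $k=|C|$ (here $k=3$). $\mathfrak{R}$ is the set of bijections $r:C\to\{0,\dots,k-1\}$ (rankings; a larger value means ranked higher). An election is a function $e:V\to\mathfrak{R}$. $\mathfrak{R}_=$ is the set of weak orderings $\succ$ of $C$ (an equivalence relation of tying together with a total order of winning on the classes; $c_i\succ c_j$ means $c_i$ strictly beats $c_j$). A social welfare function (SWF) is a function $F:E\to\mathfrak{R}_=$, where $E$ is a set of elections. For $i\neq j$: $\pi_{i,j}(r)=r(c_i)-r(c_j)\in D_k=\{1-k,\dots,-1,1,\dots,k-1\}$; for $e\in E$, $\pi_{i,j}(e):V\to D_k$ is $v\mapsto\pi_{i,j}(e(v))$; $A_{i,j}=\pi_{i,j}(E)$; for $\succ\in\mathfrak{R}_=$, $\pi_{i,j}(\succ)=W$ if $c_i\succ c_j$, $L$ if $c_j\succ c_i$, $T$ otherwise. Order: $W>T>L$. Promotion: for rankings $r_1,r_2$ and $c_i\ne c_j$, $(c_j,c_i)$ is promoted by $(r_2,r_1)$ if for all candidates $c_m,c_\ell\notin\{c_i,c_j\}$: (i) $r_1(c_m)>r_1(c_i)\Rightarrow r_2(c_m)>r_2(c_i)$; (ii) $r_1(c_j)>r_1(c_m)\Rightarrow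 r_2(c_j)>r_2(c_m)$; (iii) $r_1(c_j)>r_1(c_i)\Rightarrow r_2(c_j)>r_2(c_i)$; (iv) $r_1(c_m)>r_1(c_\ell)\Leftrightarrow r_2(c_m)>r_2(c_\ell)$. For elections, $(c_j,c_i)$ is promoted by $(e_2,e_1)$ if it is promoted by $(e_2(v),e_1(v))$ for every $v\in V$. Conditions on $F$: - U: $E=\mathfrak{R}^V$. - MIIA: for all $i\ne j$ there is $f_{i,j}:A_{i,j}\to\{W,T,L\}$ with $f_{i,j}(\pi_{i,j}(e))=\pi_{i,j}(F(e))$ for all $e\in E$. - A: $F(e)$ depends only on $\tau(e)\in\mathbb{R}_{\ge0}^{\mathfrak{R}}$, $\tau(e)(r)=|e^{-1}(r)|$. - N: for every permutation $\rho$ of $C$ and all $e\in E$ with $\rho\circ e\in E$, $F(\rho\circ e)=\rho(F(e))$. Here $(\rho\circ e)(v)=\rho(e(v))$ with $\rho(r)=r\circ\rho^{-1}$, and $\rho(\succ)$ is the weak ordering in which $\rho(c_i)$ beats $\rho(c_j)$ iff $c_i\succ c_j$. - P: if $\pi_{i,j}(e)(v)>0$ for all $v\in V$ then $\pi_{i,j}(F(e))=W$. - PR: whenever $(c_j,c_i)$ is promoted by $(e_2,e_1)$, $\pi_{i,j}(F(e_1))\ge\pi_{i,j}(F(e_2))$. Borda rules: for weights $w=(w_v)_{v\in V}\in\mathbb{R}^V$, the Borda rule $B_w$ is the SWF ranking candidates by the score $b_w(c,e)=\sum_{v\in V}e(v)(c)\,w_v$ (i.e. $c_i$ beats $c_j$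 iff $b_w(c_i,e)>b_w(c_j,e)$). The tie rule is the SWF under which all candidates are always tied (the case $w\equiv 0$). $F$ is weakly Borda if there is $w\not\equiv0$ such that for all $e\in E$ and $i\neq j$, $\pi_{i,j}(B_w(e))\neq T$ implies $\pi_{i,j}(F(e))=\pi_{i,j}(B_w(e))$. $F$ is strongly non-Borda if it is neither weakly Borda nor the tie rule. *)

(* Defs.v *)
From mathcomp Require Import all_boot all_order all_fingroup all_algebra.
From mathcomp Require Import reals.

Set Implicit Arguments.
Unset Strict Implicit.
Unset Printing Implicit Defensive.

Import Order.TTheory GRing.Theory Num.Theory.
Local Open Scope ring_scope.

(* The candidates c_1, ..., c_k are the elements of 'I_k.  A ranking is a
   bijection from the candidates to {0, ..., k-1}, i.e. an element of 'S_k;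
   r c is the position of c, larger meaning higher. *)
Definition ranking (k : nat) : finType := 'S_k.

Definition election (V : finType) (k : nat) : finType := {ffun V -> ranking k}.

Section WeakOrderings.
Variable C : finType.
Implicit Types tied beats : {set C * C}.

Definition is_equivalence tied : bool :=
  [&& [forall x, (x, x) \in tied],
      [forall x, forall y, ((x, y) \in tied) ==> ((y, x) \in tied)] &
      [forall x, forall y, forall z,
         ((x, y) \in tied) && ((y, z) \in tied) ==> ((x, z) \in tied)]].

(* beats is compatible with the equivalence tied, and the relation that it
   induces on the classes is a strict total order. *)
Definition is_order_on_classes tied beats : bool :=
  [&& [forall x, forall x', forall y, forall y',
         ((x, x') \in tied) && ((y, y') \in tied) ==>
           (((x, y) \in beats) == ((x', y') \in beats))],
      [forall x, (x, x) \notin beats],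
      [forall x, forall y, forall z,
         ((x, y) \in beats) && ((y, z) \in beats) ==> ((x, z) \in beats)] &
      [forall x, forall y,
         ((x, y) \notin tied) ==> ((x, y) \in beats) || ((y, x) \in beats)]].

(* The axioms are booleans and the relations are finite sets, so that Leibniz
   equality of weak orderings is equality of the relations. *)
Record weak_ordering : Type := WeakOrdering {
  tied : {set C * C};
  beats : {set C * C};
  weak_orderingP : is_equivalence tied && is_order_on_classes tied beats
}.

Lemma weak_ordering_eq (o1 o2 : weak_ordering) :
  tied o1 = tied o2 -> beats o1 = beats o2 -> o1 = o2.
Proof.
case: o1 o2 => [t1 b1 p1] [t2 b2 p2] /= et eb; case: _ / et p2 => p2.
case: _ / eb p2 => p2; congr WeakOrdering; exact: bool_irrelevance.
Qed.

Lemma perm_weak_ordering_proof (rho : {perm C}) (o : weak_ordering) :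
  let T := [set p | ((rho^-1)%g p.1, (rho^-1)%g p.2) \in tied o] in
  let B := [set p | ((rho^-1)%g p.1, (rho^-1)%g p.2) \in beats o] in
  is_equivalence T && is_order_on_classes T B.
Proof.
case: o => t b /= /andP[/and3P[/forallP t1 /forallP t2 /forallP t3]].
move=> /and4P[/forallP b1 /forallP b2 /forallP b3 /forallP b4].
apply/andP; split; first apply/and3P; last apply/and4P; split.
- by apply/forallP => x; rewrite inE.
- by apply/forallP => x; apply/forallP => y; rewrite !inE; move/forallP: (t2 ((rho^-1)%g x)).
- apply/forallP => x; apply/forallP => y; apply/forallP => z; rewrite !inE.
  by move/forallP: (t3 ((rho^-1)%g x)) => /(_ ((rho^-1)%g y)) /forallP.
- apply/forallP => x; apply/forallP => x'; apply/forallP => y; apply/forallP => y'.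
  rewrite !inE; move/forallP: (b1 ((rho^-1)%g x)) => /(_ ((rho^-1)%g x')) /forallP.
  by move=> /(_ ((rho^-1)%g y)) /forallP.
- by apply/forallP => x; rewrite inE.
- apply/forallP => x; apply/forallP => y; apply/forallP => z; rewrite !inE.
  by move/forallP: (b3 ((rho^-1)%g x)) => /(_ ((rho^-1)%g y)) /forallP.
- by apply/forallP => x; apply/forallP => y; rewrite !inE; move/forallP: (b4 ((rho^-1)%g x)).
Qed.

(* rho x beats rho y in the result iff x beats y in o. *)
Definition perm_weak_ordering (rho : {perm C}) (o : weak_ordering) :
  weak_ordering := WeakOrdering (perm_weak_ordering_proof rho o).

Lemma perm_weak_ordering_beats (rho : {perm C}) o x y :
  ((rho x, rho y) \in beats (perm_weak_ordering rho o)) = ((x, y) \in beats o).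
Proof. by rewrite inE /= !permK. Qed.

Section Score.
Variables (R : realType) (s : C -> R).

Lemma score_ordering_proof :
  let T := [set p : C * C | s p.1 == s p.2] in
  let B := [set p : C * C | s p.1 > s p.2] in
  is_equivalence T && is_order_on_classes T B.
Proof.
apply/andP; split; first apply/and3P; last apply/and4P; split.
- by apply/forallP => x; rewrite inE.
- by apply/forallP => x; apply/forallP => y; rewrite !inE /= eq_sym implybb.
- apply/forallP => x; apply/forallP => y; apply/forallP => z; rewrite !inE /=.
  by apply/implyP => /andP[/eqP -> /eqP ->].
- apply/forallP => x; apply/forallP => x'; apply/forallP => y; apply/forallP => y'.
  by rewrite !inE /=; apply/implyP => /andP[/eqP -> /eqP ->].
- by apply/forallP => x; rewrite inE ltxx.
- apply/forallP => x; apply/forallP => y; apply/forallP => z; rewrite !inE /=.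
  by apply/implyP => /andP[xy yz]; apply: lt_trans yz xy.
- by apply/forallP => x; apply/forallP => y; rewrite !inE /= neq_lt orbC implybb.
Qed.

Definition score_ordering : weak_ordering := WeakOrdering score_ordering_proof.
End Score.

End WeakOrderings.

Variant outcome : Type := W | T | L.

Definition outcome_level (o : outcome) : nat :=
  match o with W => 2 | T => 1 | L => 0 end.

Definition outcome_ge (o1 o2 : outcome) : bool :=
  (outcome_level o2 <= outcome_level o1)%N.

(* A social welfare function whose set of elections is E. *)
Definition swf (V : finType) (k : nat) (E : {set election V k}) : Type :=
  {e : election V k | e \in E} -> weak_ordering 'I_k.

Section Projections.
Variables (V : finType) (k : nat).
Implicit Types (i j : 'I_k) (r : ranking k).

Definition pi_ranking i j r : int := (r i)%:Z - (r j)%:Z.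

Definition pi_election i j (e : election V k) : {ffun V -> int} :=
  [ffun v => pi_ranking i j (e v)].

Definition pi_ordering i j (o : weak_ordering 'I_k) : outcome :=
  if (i, j) \in beats o then W else if (j, i) \in beats o then L else T.

(* rho (r) = r \o rho^-1; products in 'S_k are composed from left to right. *)
Definition perm_ranking (rho : 'S_k) r : ranking k := (rho^-1 * r)%g.

Lemma perm_rankingE (rho : 'S_k) r c : perm_ranking rho r c = r ((rho^-1)%g c).
Proof. by rewrite permM. Qed.

Definition perm_election (rho : 'S_k) (e : election V k) : election V k :=
  [ffun v => perm_ranking rho (e v)].

Definition tau (e : election V k) : {ffun ranking k -> nat} :=
  [ffun r => #|[set v | e v == r]|].

(* "(c_j, c_i) is promoted by (r2, r1)" *)
Definition promoted_ranking j i (r2 r1 : ranking k) : Prop :=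
  [/\ forall m, m != i -> m != j -> (r1 i < r1 m)%N -> (r2 i < r2 m)%N,
      forall m, m != i -> m != j -> (r1 m < r1 j)%N -> (r2 m < r2 j)%N,
      (r1 i < r1 j)%N -> (r2 i < r2 j)%N &
      forall m l, m != i -> m != j -> l != i -> l != j ->
        (r1 l < r1 m)%N <-> (r2 l < r2 m)%N].

Definition promoted j i (e2 e1 : election V k) : Prop :=
  forall v, promoted_ranking j i (e2 v) (e1 v).

Section Conditions.
Variables (E : {set election V k}) (F : swf E).

Local Notation dom := {e : election V k | e \in E}.

Definition unrestricted_domain : Prop := E = [set: election V k].

(* Only the values of f on A_{i,j}, the image of E under pi_election i j, are
   constrained, so f stands for an arbitrary function A_{i,j} -> {W, T, L}. *)
Definition MIIA : Prop :=
  forall i j, i != j -> exists f : {ffun V -> int} -> outcome,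
    forall e : dom, f (pi_election i j (val e)) = pi_ordering i j (F e).

Definition anonymity : Prop :=
  forall e e' : dom, tau (val e) = tau (val e') -> F e = F e'.

(* The existence of e' expresses that rho \o e lies in E. *)
Definition neutrality : Prop :=
  forall (rho : 'S_k) (e e' : dom), val e' = perm_election rho (val e) ->
    F e' = perm_weak_ordering rho (F e).

Definition pareto : Prop :=
  forall i j, i != j -> forall e : dom,
    (forall v, 0 < pi_election i j (val e) v) -> pi_ordering i j (F e) = W.

Definition positive_responsiveness : Prop :=
  forall i j, i != j -> forall e1 e2 : dom,
    promoted j i (val e2) (val e1) ->
    outcome_ge (pi_ordering i j (F e1)) (pi_ordering i j (F e2)).

End Conditions.

Section Borda.
Variable R : realType.

Definition borda_score (w : V -> R) (e : election V k) (c : 'I_k) : R :=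
  \sum_(v : V) (e v c)%:R * w v.

Definition borda (w : V -> R) (E : {set election V k}) : swf E :=
  fun e => score_ordering (borda_score w (val e)).

Variables (E : {set election V k}) (F : swf E).
Local Notation dom := {e : election V k | e \in E}.

Definition is_tie_rule : Prop := forall (e : dom) i j, (i, j) \in tied (F e).

Definition weakly_borda : Prop :=
  exists w : V -> R, (exists v, w v != 0) /\
    forall (e : dom) i j, i != j -> pi_ordering i j (borda w e) <> T ->
      pi_ordering i j (F e) = pi_ordering i j (borda w e).

Definition strongly_non_borda : Prop := ~ weakly_borda /\ ~ is_tie_rule.
End Borda.

End Projections.

Arguments strongly_non_borda {V k} R {E} F.
Arguments weakly_borda {V k} R {E} F.

(* Main.v *)
(* Take the unweighted Borda rule, and let d be the vector of rank differences
   between c_i and c_j.  For three candidates the margins (the sums of the d's)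
   of the pairs of a cycle agree modulo 3, so a margin of 1 excludes ties in
   that cycle.  Now declare c_i and c_j tied whenever the margin is 1 and more
   voters have d = 2 than d = -1 (and symmetrically).  At most one pair of a
   cycle can be exceptional in this way, so the outcome stays transitive, and
   since only margins +-1 are affected the rule stays monotone.  If it were
   weakly Borda for w, all permutations of an exceptional d would have
   w-weighted sum 0, which forces w to be constant, hence 0. *)

Require Import Defs.
From mathcomp Require Import all_boot all_order all_fingroup all_algebra.
From mathcomp Require Import reals.
From mathcomp Require Import zify.

Set Implicit Arguments.
Unset Strict Implicit.
Unset Printing Implicit Defensive.

Import Order.TTheory GRing.Theory Num.Theory.
Local Open Scope ring_scope.

(** * Weak orderings from negatively transitive relations *)

(** The contrapositive of the second hypothesis makes the complement of [b] transitive, so being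
    unrelated in both directions is an equivalence compatible with [b]. *)
Lemma strict_weak_ordering_proof (C : finType) (b : rel C) :
    (forall x y, b x y -> ~~ b y x) ->
    (forall x y z, b x z -> b x y || b y z) ->
  let T := [set p : C * C | ~~ b p.1 p.2 && ~~ b p.2 p.1] in
  let B := [set p : C * C | b p.1 p.2] in
  is_equivalence T && is_order_on_classes T B.
Proof.
move=> asym ntrans.
have irr x : b x x = false by apply/negP => bxx; move: (asym _ _ bxx); rewrite bxx.
have nt x y z : ~~ b x y -> ~~ b y z -> ~~ b x z.
  by move=> /negPf nxy /negPf nyz; apply/negP => /(ntrans _ y); rewrite nxy nyz.
apply/andP; split; first apply/and3P; last apply/and4P; split.
- by apply/forallP => x; rewrite inE /= irr.
- by apply/'forall_forallP => x y; rewrite !inE /= andbC implybb.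
- apply/'forall_forallP => x y; apply/forallP => z; rewrite !inE /=.
  apply/implyP => /andP[/andP[xy yx] /andP[yz zy]].
  by rewrite (nt _ _ _ xy yz) (nt _ _ _ zy yx).
- apply/'forall_forallP => x x'; apply/'forall_forallP => y y'; rewrite !inE /=.
  apply/implyP => /andP[/andP[xx' x'x] /andP[yy' y'y]]; apply/eqP.
  apply/idP/idP => h.
    have := ntrans _ x' _ h; rewrite (negPf xx') /= => /(ntrans _ y').
    by rewrite (negPf y'y) orbF.
  have := ntrans _ x _ h; rewrite (negPf x'x) /= => /(ntrans _ y).
  by rewrite (negPf yy') orbF.
- by apply/forallP => x; rewrite inE /= irr.
- apply/'forall_forallP => x y; apply/forallP => z; rewrite !inE /=.
  apply/implyP => /andP[xy yz]; have := ntrans _ z _ xy.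
  by rewrite (negPf (asym _ _ yz)) orbF.
- apply/'forall_forallP => x y; rewrite !inE /=.
  by apply/implyP; rewrite negb_and !negbK.
Qed.

(** * Margins and verdicts of difference vectors *)

Section DifferenceVectors.
Variable V : finType.
Implicit Types d : {ffun V -> int}.

Definition margin d : int := \sum_v d v.

Definition votes d (q : int) : nat := #|[set v | d v == q]|.

Definition wins d : bool :=
  (0 < margin d) && ~~ ((margin d == 1) && (votes d (-1) < votes d 2)%N).

(** A defeat is a win of the opposite vector, so at margin -1 the exception compares the entries -2
    with the entries 1. *)
Definition verdict d : outcome :=
  if wins d then W else if wins (- d) then L else T.

Lemma marginD d1 d2 : margin (d1 + d2) = margin d1 + margin d2.
Proof. by rewrite -big_split; apply: eq_bigr => v _; rewrite ffunE. Qed.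

Lemma marginN d : margin (- d) = - margin d.
Proof. by rewrite -sumrN; apply: eq_bigr => v _; rewrite ffunE. Qed.

Lemma wins_margin d : 1 < margin d -> wins d.
Proof. by rewrite /wins => h; apply/andP; split; lia. Qed.

Lemma winsN d : wins d -> ~~ wins (- d).
Proof. by rewrite /wins marginN => /andP[h _]; apply/negP => /andP[]; lia. Qed.

(** Margins are integers: if the vectors differ, the margin grows from at least 1 to at least 2,
    where no exception applies. *)
Lemma wins_homo d1 d2 : (forall v, d1 v <= d2 v) -> wins d1 -> wins d2.
Proof.
move=> le12; have [-> //|/eqP/ffunP ne] := eqVneq d1 d2.
move=> /andP[m1 _]; apply: wins_margin.
suff : margin d1 < margin d2 by lia.
have [v nv|eq12] := pickP (fun v => d1 v != d2 v); last first.
  by case: ne => v; apply/eqP; move: (eq12 v) => /negbFE.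
rewrite /margin (bigD1 v) //= [ltRHS](bigD1 v) //=.
by apply: ltr_leD; [rewrite lt_neqAle nv le12 | apply: ler_sum].
Qed.

Lemma verdict_homo d1 d2 : (forall v, d1 v <= d2 v) ->
  outcome_ge (verdict d2) (verdict d1).
Proof.
move=> le12; rewrite /verdict.
have := wins_homo le12; have : wins (- d2) -> wins (- d1).
  by apply: wins_homo => v; rewrite !ffunE lerN2.
case: (wins (- d2)) => [-> // H|_]; last first.
  by case: (wins d1) => [->|]; case: (wins d2); case: (wins (- d1)).
by case: (wins d1) H => [-> //|_]; case: (wins d2).
Qed.

(* Two exceptional margins of 1 would give the impossible cycle
   #(d1=2) <= #(d2=-1) < #(d2=2) <= #(d1=-1) < #(d1=2). *)
Lemma wins_ntrans d1 d2 :
    (exists q, margin d1 = margin d2 + 3 * q) ->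
    (forall v, d1 v = 2 -> d2 v = -1) -> (forall v, d2 v = 2 -> d1 v = -1) ->
  wins (d1 + d2) -> wins d1 || wins d2.
Proof.
move=> [q mq] h12 h21; rewrite /wins marginD => /andP[m12 _].
have c12 : (votes d1 2 <= votes d2 (-1))%N.
  by apply: subset_leq_card; apply/subsetP => v; rewrite !inE => /eqP/h12->.
have c21 : (votes d2 2 <= votes d1 (-1))%N.
  by apply: subset_leq_card; apply/subsetP => v; rewrite !inE => /eqP/h21->.
(* If neither vector wins although the margins have a positive sum, these are 1 and 1, the cycle
   excluded by [c12] and [c21], or 1 and 0 in some order, excluded modulo 3. *)
apply/orP; lia.
Qed.

End DifferenceVectors.

(** * Rankings of three candidates *)

Lemma ord3_third (i j : 'I_3) : i != j -> exists m : 'I_3, m != i /\ m != j.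
Proof.
move: i j => [[|[|[|//]]] hi] [[|[|[|//]]] hj] // _.
- by exists (inord 2); rewrite -!val_eqE /= inordK.
- by exists (inord 1); rewrite -!val_eqE /= inordK.
- by exists (inord 2); rewrite -!val_eqE /= inordK.
- by exists (inord 0); rewrite -!val_eqE /= inordK.
- by exists (inord 1); rewrite -!val_eqE /= inordK.
- by exists (inord 0); rewrite -!val_eqE /= inordK.
Qed.

Lemma ranking_neq k (r : ranking k) (i j : 'I_k) : i != j -> (r i : nat) <> r j.
Proof. by move=> /eqP nij /val_inj /perm_inj. Qed.

(** This eliminates the third candidate and is the source of the congruence of margins modulo 3. *)
Lemma ranking3_sum (r : ranking 3) (i j m : 'I_3) :
  i != j -> j != m -> i != m -> (r i + r j + r m = 3)%N.
Proof.
move=> /(ranking_neq (r := r)) ij /(ranking_neq (r := r)) jm /(ranking_neq (r := r)) im.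
have := (ltn_ord (r i), ltn_ord (r j), ltn_ord (r m)).
by case=> [[]]; lia.
Qed.

(** A position counts the candidates ranked below. From [r2] to [r1], the first and third clauses of
    promotion keep [i] from falling, the second and third keep [j] from rising. *)
Lemma promoted_ranking_le i j (r1 r2 : ranking 3) : i != j ->
  promoted_ranking j i r2 r1 -> pi_ranking i j r2 <= pi_ranking i j r1.
Proof.
move=> nij; have [m [mi mj]] := ord3_third nij.
case=> /(_ m mi mj) pim /(_ m mi mj) pjm pij _; rewrite /pi_ranking.
have jm : j != m by rewrite eq_sym.
have im : i != m by rewrite eq_sym.
have e1 := ranking3_sum r1 nij jm im; have e2 := ranking3_sum r2 nij jm im.
have n1 := ranking_neq (r := r1) nij; have n2 := ranking_neq (r := r1) jm.
have n3 := ranking_neq (r := r1) im; have n4 := ranking_neq (r := r2) nij.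
have n5 := ranking_neq (r := r2) jm; have n6 := ranking_neq (r := r2) im.
move: (nat_of_ord (r1 i)) (nat_of_ord (r1 j)) (nat_of_ord (r1 m))
  (nat_of_ord (r2 i)) (nat_of_ord (r2 j)) (nat_of_ord (r2 m)) pim pjm pij e1 e2
  n1 n2 n3 n4 n5 n6 => a b c a' b' c'; lia.
Qed.

(** * The modified Borda rule and its anonymity *)

Section Rule.
Variable V : finType.
Implicit Types (e : election V 3) (i j m : 'I_3).

Definition defeats e : rel 'I_3 := fun i j => wins (pi_election i j e).

Lemma pi_electionN i j e : pi_election j i e = - pi_election i j e.
Proof. by apply/ffunP => v; rewrite !ffunE /pi_ranking opprB. Qed.

Lemma pi_electionD i j m e :
  pi_election i m e = pi_election i j e + pi_election j m e.
Proof. by apply/ffunP => v; rewrite !ffunE /pi_ranking addrA subrK. Qed.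

Lemma defeats_asym e i j : defeats e i j -> ~~ defeats e j i.
Proof. by rewrite /defeats (pi_electionN i j); apply: winsN. Qed.

Lemma defeats_ntrans e i j m : defeats e i m -> defeats e i j || defeats e j m.
Proof.
have [->|nij] := eqVneq i j; first by move=> ->; rewrite orbT.
have [->|njm] := eqVneq j m; first by move=> ->.
have [->|nim] := eqVneq i m.
  by move=> h; move: (defeats_asym h); rewrite h.
have sum v := ranking3_sum (e v) nij njm nim.
rewrite /defeats (pi_electionD i j); apply: wins_ntrans => [|v|v].
(* For a ranking [r], the two differences differ by [r i - 2 * r j + r m], which is [3 * (1 - r j)]
   because the positions sum to 3. *)
- exists (\sum_v (1 - (e v j)%:Z)); rewrite mulr_sumr -big_split /=.
  apply: eq_bigr => v _; rewrite !ffunE /pi_ranking; move: (sum v).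
  move: (nat_of_ord (e v i)) (nat_of_ord (e v j)) (nat_of_ord (e v m)) => x y z.
  lia.
(* A difference of 2 puts [i] on top and [j] at the bottom, so [m] is in the middle, one above [j];
   the next case is analogous. *)
- rewrite !ffunE /pi_ranking; move: (sum v) (ltn_ord (e v i)).
  move: (nat_of_ord (e v i)) (nat_of_ord (e v j)) (nat_of_ord (e v m)) => x y z.
  lia.
- rewrite !ffunE /pi_ranking; move: (sum v) (ltn_ord (e v j)).
  move: (nat_of_ord (e v i)) (nat_of_ord (e v j)) (nat_of_ord (e v m)) => x y z.
  lia.
Qed.

Definition rule_ordering e : weak_ordering 'I_3 :=
  WeakOrdering (strict_weak_ordering_proof
    (@defeats_asym e) (@defeats_ntrans e)).

Lemma pi_rule_ordering i j e :
  pi_ordering i j (rule_ordering e) = verdict (pi_election i j e).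
Proof. by rewrite /pi_ordering !inE /= /defeats (pi_electionN i j). Qed.

Lemma rule_ordering_eq e1 e2 :
  (forall i j, defeats e1 i j = defeats e2 i j) ->
  rule_ordering e1 = rule_ordering e2.
Proof.
by move=> h; apply: weak_ordering_eq; apply/setP => p; rewrite !inE ?h.
Qed.

(** Voters are grouped by ranking. This serves for margins, in [int], and for votes, as sums of
    indicators in [nat]. *)
Lemma sum_tau (M : nmodType) (phi : ranking 3 -> M) e :
  \sum_v phi (e v) = \sum_r phi r *+ tau e r.
Proof.
rewrite (partition_big e predT) //=; apply: eq_bigr => r _.
rewrite (eq_bigr (fun=> phi r)) => [|v /eqP -> //].
by rewrite sumr_const ffunE cardsE.
Qed.

Lemma defeats_tau e1 e2 i j : tau e1 = tau e2 -> defeats e1 i j = defeats e2 i j.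
Proof.
move=> eqt.
have mE e : margin (pi_election i j e) = \sum_r pi_ranking i j r *+ tau e r.
  by rewrite -sum_tau; apply: eq_bigr => v _; rewrite ffunE.
have vE q e : votes (pi_election i j e) q
    = \sum_r (pi_ranking i j r == q : nat) *+ tau e r.
  rewrite -(sum_tau (fun r => pi_ranking i j r == q : nat)) /votes -sum1dep_card.
  by rewrite big_mkcond; apply: eq_bigr => v _; rewrite ffunE; case: eqP.
by rewrite /defeats /wins !mE !vE eqt.
Qed.

End Rule.

(** * Excluding weighted Borda rules *)

(** Exchanging the entries at [a] and [b] changes the sum by [d a - d b] times a difference of two
    weights, so all weights coincide; the common weight times the nonzero sum of [d] is then 0. *)
Lemma weights_eq0 (V : finType) (R : numDomainType) (d : V -> int) (w : V -> R) a b :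
    (forall s : {perm V}, \sum_v (d (s v))%:~R * w v = 0) ->
    d a != d b -> \sum_v d v != 0 ->
  forall v, w v = 0.
Proof.
move=> sum0 dab sumd.
have sum0' (s : {perm V}) : \sum_v (d v)%:~R * w (s v) = 0.
  rewrite -[RHS](sum0 s^-1%g) [RHS](reindex_inj (@perm_inj _ s)).
  by apply: eq_bigr => v _; rewrite permK.
have nab : a != b by apply: contraNneq dab => ->.
have nba : b != a by rewrite eq_sym.
have swap (s : {perm V}) : w (s a) = w (s b).
  have := sum0' (tperm a b * s)%g; rewrite -[RHS](sum0' s).
  rewrite (bigD1 a) //= (bigD1 b) //= [RHS](bigD1 a) //= [in RHS](bigD1 b) //=.
  rewrite !permM tpermL tpermR.
  rewrite (eq_bigr (fun v => (d v)%:~R * w (s v))) => [|v /andP[va vb]]; last first.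
    by rewrite permM tpermD // eq_sym.
  rewrite !addrA => /addIr eqw.
  have : ((d a)%:~R - (d b)%:~R) * (w (s a) - w (s b)) = 0 :> R.
    by rewrite mulrBl !mulrBr opprB addrACA -opprD -eqw subrr.
  move/eqP; rewrite mulf_eq0 !subr_eq0 eqr_int (negPf dab) /=.
  by move/eqP.
have const v : w v = w b.
  have [-> //|nvb] := eqVneq v b.
  (* The transposition of [a] and [v] sends [a] to [v] and fixes [b]. *)
  by have := swap (tperm a v); rewrite tpermL tpermD // eq_sym.
have /eqP := sum0 1%g; rewrite (eq_bigr (fun v => (d v)%:~R * w b)); last first.
  by move=> v _; rewrite perm1 const.
rewrite -mulr_suml -rmorph_sum mulf_eq0 intr_eq0 (negPf sumd) /= => /eqP wb v.
by rewrite const.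
Qed.

(** No entry is -1, so a single entry 2 already makes the margin 1 exceptional; the two unequal
    entries serve to compare weights. *)
Lemma exceptional_vector (V : finType) : (6 < #|V|)%N ->
  exists d : {ffun V -> int}, exists a b,
    [/\ forall v, d v \in [:: 2; 1; -2], margin d = 1,
        (votes d (-1) < votes d 2)%N & d a != d b].
Proof.
move=> V6; pose n := #|V|; pose m := ((n + 2) %/ 3)%N; pose k := (3 * m + 1 - n)%N.
(* k entries 2, n - m - k entries 1 and m entries -2 have sum n + k - 3 * m = 1. *)
pose D (i : nat) : int := if (i < k)%N then 2 else if (i < n - m)%N then 1 else -2.
have hm : (3 <= m)%N by rewrite /m; lia.
(* [m] is the ceiling of [n / 3], so [k] is 1, 2 or 3, while [n - m] is at least 4 from seven voters
   on. *)
have hk : (0 < k <= n - m)%N by rewrite /k /m /n; lia.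
have h0 : (0 < n)%N by lia.
have h1 : (n.-1 < n)%N by lia.
pose a : V := enum_val (Ordinal h0); pose b : V := enum_val (Ordinal h1).
exists [ffun v => D (enum_rank v)], a, b.
have Da : D (enum_rank a) = 2 by rewrite enum_valK /D /=; case/andP: hk => ->.
split.
- by move=> v; rewrite ffunE /D; case: ifP => // _; case: ifP.
- rewrite /margin (eq_bigr (fun v => D (enum_rank v))) => [|v _]; last by rewrite ffunE.
  rewrite (reindex _ (onW_bij _ (enum_val_bij V))) /=.
  rewrite (eq_bigr (fun i : 'I_n => D i)) => [|i _]; last by rewrite enum_valK.
  rewrite -(big_mkord predT D) (big_cat_nat _ (n := k)) //=; last by lia.
  rewrite [X in _ + X](big_cat_nat _ (n := (n - m)%N)) //=; try lia.
  rewrite (eq_big_nat _ _ (F2 := fun=> 2)) => [|i hi]; last first.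
    by rewrite /D; case/andP: hi => _ ->.
  rewrite (eq_big_nat _ _ (F1 := D) (F2 := fun=> 1)) => [|i /andP[hi hi']]; last first.
    by rewrite /D ltnNge hi hi'.
  rewrite (eq_big_nat _ _ (F1 := D) (F2 := fun=> -2)) => [|i /andP[hi hi']]; last first.
    by rewrite /D ltnNge (leq_trans _ hi) /= 1?ltnNge ?hi //; case/andP: hk.
  rewrite !sumr_const_nat /k /m /n; lia.
- apply: (@leq_ltn_trans 0); last first.
    by apply/card_gt0P; exists a; rewrite inE ffunE Da.
  rewrite leqn0 cards_eq0; apply/eqP/setP => v; rewrite !inE ffunE /D.
  by case: ifP => // _; case: ifP.
- rewrite !ffunE Da enum_valK /D /=.
  rewrite (_ : (n.-1 < k)%N = false); last by lia.
  by rewrite (_ : (n.-1 < n - m)%N = false); last by lia.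
Qed.

Lemma ranking3_of_difference (q : int) : q \in [:: 2; 1; -2] ->
  exists r : ranking 3, pi_ranking 0 1 r = q.
Proof.
rewrite !inE => /or3P[] /eqP ->.
- exists (tperm (0 : 'I_3)%R (1 : 'I_3)%R * tperm (1 : 'I_3)%R (2 : 'I_3)%R)%g.
  by rewrite /pi_ranking !permM !(tpermL, tpermR) tpermD.
- by exists (tperm 0 1); rewrite /pi_ranking tpermL tpermR.
- by exists (tperm 1 2); rewrite /pi_ranking tpermL tpermD.
Qed.

Lemma election3_of_differences (V : finType) (d : {ffun V -> int}) :
  (forall v, d v \in [:: 2; 1; -2]) ->
  exists e : election V 3, pi_election 0 1 e = d.
Proof.
(* The boolean form of the equation lets [xchoose] pick a ranking for each voter. *)
move=> hd; have {}hd v : exists r : ranking 3, pi_ranking 0 1 r == d v.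
  by have [r <-] := ranking3_of_difference (hd v); exists r.
exists [ffun v => xchoose (hd v)]; apply/ffunP => v; rewrite !ffunE.
exact/eqP/(xchooseP (hd v)).
Qed.

Lemma borda_tie (V : finType) k (R : realType) (w : V -> R) (e : election V k) i j :
    pi_ordering i j (score_ordering (borda_score w e)) = T ->
  \sum_v (pi_election i j e v)%:~R * w v = 0.
Proof.
rewrite /pi_ordering !inE /=; case: ltgtP => // eqs _.
rewrite (eq_bigr (fun v => (e v i)%:R * w v - (e v j)%:R * w v)) => [|v _].
  by rewrite sumrB; apply/eqP; rewrite subr_eq0; apply/eqP.
by rewrite ffunE /pi_ranking rmorphB mulrBl.
Qed.

Lemma pi_perm_election (V : finType) k (rho : 'S_k) (e : election V k) i j :
  pi_election i j (perm_election rho e)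
  = pi_election ((rho^-1)%g i) ((rho^-1)%g j) e.
Proof. by apply/ffunP => v; rewrite !ffunE /pi_ranking !perm_rankingE. Qed.

Lemma tau_perm_voters (V : finType) k (e : election V k) (s : {perm V}) :
  tau [ffun v => e (s v)] = tau e.
Proof.
apply/ffunP => r; rewrite !ffunE.
rewrite -(card_preimset [set v | e v == r] (@perm_inj _ s)).
by apply: eq_card => v; rewrite !inE ffunE.
Qed.

Theorem mainTheorem2 (R : realType) :
  exists N : nat, forall n : nat, (N <= n)%N ->
  forall V : finType, #|V| = n ->
  exists (E : {set election V 3}) (F : swf E),
    [/\ unrestricted_domain E, MIIA F & anonymity F] /\
    [/\ neutrality F, pareto F, positive_responsiveness F &
        strongly_non_borda R F].
Proof.
exists 7%N => n n7 V cV; exists setT, (fun e => rule_ordering (val e)).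
have par : pareto (fun e : {e | e \in [set: election V 3]} => rule_ordering (val e)).
  (* All entries are at least 1, so the margin is at least [n], beyond the exceptional value 1. *)
  move=> i j nij e pos; rewrite pi_rule_ordering /verdict wins_margin //.
  have : (\sum_(v : V) 1 : int) <= margin (pi_election i j (val e)).
    by apply: ler_sum => v _; have := pos v; lia.
  by rewrite sumr_const cV; lia.
split; split=> //.
- move=> i j _; exists (fun d => verdict d) => e.
  by rewrite pi_rule_ordering.
- by move=> e e' eqt; apply: rule_ordering_eq => i j; apply: defeats_tau.
(* One criterion serves all pairs, so relabelling the candidates only relabels the difference
   vectors. *)
- move=> rho e e' e'E; apply: weak_ordering_eq; apply/setP => p; rewrite !inE /=;
    by rewrite /defeats e'E !pi_perm_election.
- move=> i j nij e1 e2 prom; rewrite !pi_rule_ordering; apply: verdict_homo => v.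
  by rewrite !ffunE; apply: promoted_ranking_le.
have V6 : (6 < #|V|)%N by rewrite cV.
split.
- case=> w [[u wu]] wB.
  have [d [a [b [dv md vd dab]]]] := exceptional_vector V6.
  have [e eE] := election3_of_differences dv.
  move/eqP: wu; apply; apply: (weights_eq0 (d := d)) dab _ _ => [s|]; last first.
    by rewrite -/(margin d) md.
  pose es : election V 3 := [ffun v => e (s v)].
  (* Permuting the voters preserves [defeats] in both directions. For [e] the margin 1 is
     exceptional and the reverse margin is negative, so neither candidate wins. *)
  have tied_es : verdict (pi_election 0 1 es) = T.
    have := defeats_tau 0 1 (tau_perm_voters e s).
    have := defeats_tau 1 0 (tau_perm_voters e s).
    rewrite /verdict -pi_electionN /defeats -/es => -> ->.
    by rewrite (pi_electionN 0 1) eE /wins marginN md vd.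
  (* A strict Borda comparison would have to agree with the tie of the rule, so the weighted scores
     tie as well. *)
  have bT : pi_ordering 0 1 (score_ordering (borda_score w es)) = T.
    have := wB (exist _ es (in_setT _)) 0 1 isT.
    rewrite /= pi_rule_ordering tied_es /borda /=.
    by case: (pi_ordering _ _ _) => // /(_ ltac:(by [])).
  rewrite -[RHS](borda_tie bT); apply: eq_bigr => v _.
  by rewrite -eE !ffunE.
- move=> tie.
  (* All voters rank candidate 1 above candidate 0, so Pareto contradicts a universal tie. *)
  pose e : election V 3 := [ffun=> 1%g].
  have := par 1 0 isT (exist _ e (in_setT _)) _; rewrite /pi_ordering.
  have := tie (exist _ e (in_setT _)) 1 0; rewrite !inE /=.
  move=> /andP[/negPf -> /negPf ->] h.
  have /h // : forall v, 0 < pi_election 1 0 e v.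
  by move=> v; rewrite !ffunE /pi_ranking !perm1.
Qed.
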